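(* Let $(X,\omega)$ be a compact Kähler manifold of dimension $n$, and let $E\subset\mathbf{C}^N\times X$ be a holomorphic vector bundle of rank $r$ (embedded as a subbundle by sections $s_1,\dots,s_N$ generating $E^*$). Let $T$ be the Gieseker point of $E$ and let $h$ be the Hermitian metric on $E$ defined by $h(e)=|e|^2_{\mathbf{C}^N}$. For $\sigma\in SL(N,\mathbf{C})$, let $h_\sigma$ be the Hermitian metric on $E$ defined by $h_\sigma(e)=|\sigma(e)|^2_{\mathbf{C}^N}$. Then $$L(h,h_\sigma)=c\,\log\frac{\|\sigma T\|^2}{\|T\|^2}.$$
   Context: Let $V=\int_X\omega^n$ and $c=\frac{2\pi n}{r}\int_X c_1(E)\wedge\omega^{n-1}$. The functional $L$ is $$L(h,h_\sigma)=\frac cV\int_X\log\left(\frac{\det(h_\sigma)}{\det(h)}\right)\frac{\omega^n}{n!}.$$ The sections $s_1,\dots,s_N\in H^0(X,E^* )$ generate $E^*$, and $e\mapsto (s(e),\pi(e))$, $s(e)=(s_1(e),\dots,s_N(e))$, embeds $E$ in $\mathbf{C}^N\times X$ ($\pi:E\to X$ the projection). Fix a basis $\tau_1,\dots,\tau_k$ of $H^0(X,\det E^* )$. Let $M$ be the vector space of matrices $(A^\mu_{i_1\cdots i_r})$ with $1\le i_1<\cdots<i_r\le N$, $1\le\mu\le k$. The Gieseker point $T=(a^\mu_{i_1\cdots i_r})\in M$ is defined by $$s_{i_1}\wedge\cdots\wedge s_{i_r}=\sum_\mu a^\mu_{i_1\cdots i_r}\tau_\mu .$$ $SL(N,\mathbf{C})$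 acts naturally on $M$ (through $\Lambda^r$ on the indices $i_1<\dots<i_r$), so that $\sigma T$ is the vector obtained in the same way from the sections $s^\sigma$ given by $s^\sigma(e)=\sigma(s(e))$. The norm on $M$ is defined by $$\log\|a\|^2=\frac1V\int_X\log\Big(\sum_{i_1<\cdots<i_r}\Big|\sum_\mu a^\mu_{i_1\cdots i_r}\tau_\mu(x)\Big|^2\Big)\frac{\omega^n}{n!},$$ where $|\cdot|$ on $\det E^*$ is computed with a fixed Hermitian metric on $\det E^*$ (the ratio $\|\sigma T\|/\|T\|$ does not depend on this choice). *)

(* Defs.v *)
From HB Require Import structures.
From mathcomp Require Import all_boot all_order all_algebra all_fingroup.
From mathcomp Require Import complex.
From mathcomp Require Import all_classical all_reals all_analysis.

Set Implicit Arguments.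
Unset Strict Implicit.
Unset Printing Implicit Defensive.

Import Order.TTheory GRing.Theory Num.Theory.
Import numFieldNormedType.Exports.

Local Open Scope classical_set_scope.
Local Open Scope ring_scope.
Local Open Scope complex_scope.

(* R[i] with the topology and the norm of its modulus, as a numClosedFieldType. *)
HB.instance Definition _ (R : realType) := Vector.copy R[i] R[i]^o.
HB.instance Definition _ (R : realType) := NormedModule.copy R[i] R[i]^o.

Section Calculus.
Context {R : realType} {n : nat}.
Local Notation C := R[i].
Local Notation Cn := 'rV[C]_n.

(* Derivative at [z] along [v] with a real increment. *)
Definition rderiv (v : Cn) (f : Cn -> R) (z : Cn) : R :=
  derive1 (fun t : R => f (z + t%:C *: v)) 0.

(* [Ck k U f]: on the open set [U], [f] is of class C^k in the real sense.  All
   real directions [v] are allowed, in particular the coordinate vectors e_j and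
   i e_j. *)
Fixpoint Ck (k : nat) (U : set Cn) (f : Cn -> R) : Prop :=
  (forall z, U z -> {for z, continuous f}) /\
  (if k is k'.+1 then forall v : Cn,
     (forall z, U z -> derivable (fun t : R => f (z + t%:C *: v)) 0 1) /\
     Ck k' U (rderiv v f)
   else True).

Definition smooth (U : set Cn) (f : Cn -> R) : Prop := forall k, Ck k U f.

(* Coordinate expression of a real differential [k]-form on an open subset of
   C^n. *)
Definition coord_form (k : nat) := Cn -> ('I_k -> Cn) -> R.

Definition ext_d (k : nat) (al : coord_form k) : coord_form k.+1 :=
  fun z v => \sum_(i < k.+1)
    (-1) ^+ i * rderiv (v i) (fun y => al y (fun j => v (lift i j))) z.

(* d^c f = i (dbar f - del f), that is, (d^c f)(v) = - df(i v); hence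
   d d^c = 2 i del dbar. *)
Definition dc (f : Cn -> R) : coord_form 1 :=
  fun z v => - rderiv ('i *: v ord0) f z.

(* The vectors e_0, i e_0, e_1, i e_1, ..., a positively oriented real basis of
   C^n when m = 2n. *)
Definition std_basis (m : nat) : 'I_m -> Cn :=
  fun j => \row_l (if l == (j : nat)./2 :> nat
                   then (if odd j then 'i else 1) else 0).

End Calculus.

(* Lebesgue integral over C^n = R^2n of a nonnegative Borel function, as an
   iterated integral (Tonelli). *)
Fixpoint lebesgue_intC (R : realType) (n : nat) :
    ('rV[R[i]]_n -> \bar R) -> \bar R :=
  if n is m.+1 then fun F =>
    (\int[lebesgue_measure]_x \int[lebesgue_measure]_y
       lebesgue_intC (fun z : 'rV[R[i]]_m =>
         F (row_mx ((x : R) +i* (y : R))%:M z)))%E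
  else fun F => F 0.

Definition alternating (K : nzRingType) (V : zmodType) (scal : K -> V -> V)
    (k : nat) (f : ('I_k -> V) -> K) : Prop :=
  (forall (v : 'I_k -> V) (i : 'I_k) (a : K) (u w : V),
     f [eta v with i |-> scal a u + w] =
     a * f [eta v with i |-> u] + f [eta v with i |-> w]) /\
  (forall (v : 'I_k -> V) (i j : 'I_k), i != j -> v i = v j -> f v = 0).

(* (l_0 /\ ... /\ l_(r-1))(v_0, ..., v_(r-1)) = det (l_a (v_b)). *)
Definition wedge_covectors (K : comNzRingType) (V : Type) (r : nat)
    (l : 'I_r -> V -> K) (v : 'I_r -> V) : K :=
  \det (\matrix_(a, b) l a (v b)).

Record chart (R : realType) (n : nat) (T : topologicalType) := Chart {
  cdom : set T;
  cmap : T -> 'rV[R[i]]_n;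
  cinv : 'rV[R[i]]_n -> T;
  cdom_open : open cdom;
  cimg_open : open (cmap @` cdom);
  cmapK : forall x, cdom x -> cinv (cmap x) = x;
  cmap_continuous : forall x, cdom x -> {for x, continuous cmap};
  cinv_continuous : forall x, cdom x -> {for cmap x, continuous cinv}
}.

(* [chart_at] picks a chart around each point, through which the tangent space
   at that point is identified with C^n.  Manifolds are nonempty. *)
Record complex_manifold (R : realType) (n : nat) := ComplexManifold {
  carrier :> ptopologicalType;
  carrier_hausdorff : hausdorff_space carrier;
  atlas : set (chart R n carrier);
  chart_at : carrier -> chart R n carrier;
  chart_at_atlas : forall x, atlas (chart_at x);
  chart_at_dom : forall x, cdom (chart_at x) x;
  chart_compat : forall phi psi, atlas phi -> atlas psi ->
    forall x, cdom phi x -> cdom psi x ->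
    differentiable (cmap psi \o cinv phi) (cmap phi x)
}.

Notation borel X := (g_sigma_algebraType (@open X)).

Section Manifold.
Context {R : realType} {n : nat} (X : complex_manifold R n).
Local Notation C := R[i].
Local Notation Cn := 'rV[C]_n.

Definition holomorphic_on (U : set X) (f : X -> C) : Prop :=
  forall phi, atlas phi -> forall x, U x -> cdom phi x ->
  differentiable (f \o cinv phi : Cn -> C^o) (cmap phi x).

Definition smooth_on (U : set X) (f : X -> R) : Prop :=
  forall phi, atlas phi ->
  smooth (cmap phi @` (cdom phi `&` U)) (f \o cinv phi).

Definition Csmooth_on (U : set X) (f : X -> C) : Prop :=
  smooth_on U (fun x => complex.Re (f x)) /\
  smooth_on U (fun x => complex.Im (f x)).

(* Real [k]-forms; the tangent space at [x] is C^n through [chart_at x]. *)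
Definition dform (k : nat) := X -> ('I_k -> Cn) -> R.

(* Expression of a form in the coordinates of [phi]: the differential below
   turns tangent vectors written in [phi] into tangent vectors written in the
   preferred chart of the point. *)
Definition in_chart (k : nat) (phi : chart R n X) (al : dform k) :
    coord_form k :=
  fun z v => al (cinv phi z)
    (fun i => 'd (cmap (chart_at (cinv phi z)) \o cinv phi) z (v i)).

Definition wedge_form (p q : nat) (al : dform p) (be : dform q) : dform (p + q) :=
  fun x v => ((p`! * q`!)%N%:R)^-1 * \sum_(s : 'S_(p + q))
    (-1) ^+ s * al x (fun i => v (s (lshift q i)))
              * be x (fun j => v (s (rshift p j))).

Fixpoint wedge_pow (w : dform 2) (m : nat) : dform (m * 2) :=
  if m is m'.+1 then wedge_form w (@wedge_pow w m') else fun _ _ => 1.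
Arguments wedge_pow : clear implicits.

Definition vpair (u v : Cn) : 'I_2 -> Cn :=
  fun i => if i == ord0 then u else v.

Record kahler_form (w : dform 2) : Prop := KahlerForm {
  kahler_alternating :
    forall x, alternating (fun (a : R) (v : Cn) => a%:C *: v) (w x);
  kahler_smooth : forall phi, atlas phi -> forall v,
    smooth (cmap phi @` cdom phi) (fun z => in_chart phi w z v);
  kahler_11 : forall x u v, w x (vpair ('i *: u) ('i *: v)) = w x (vpair u v);
  kahler_positive : forall x u, u != 0 -> 0 < w x (vpair u ('i *: u));
  kahler_closed : forall phi, atlas phi -> forall z v,
    (cmap phi @` cdom phi) z -> ext_d (in_chart phi w) z v = 0
}.

(* [mu] is the Borel measure A |-> int_A theta of a positive form [theta] of top
   degree [m] = 2n; the measure is determined by its values on Borel subsets of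
   chart domains. *)
Definition measure_of_form (m : nat) (theta : dform m)
    (mu : {measure set (borel X) -> \bar R}) : Prop :=
  forall phi, atlas phi -> forall A : set (borel X), measurable A ->
  A `<=` cdom phi ->
  mu A = lebesgue_intC (fun z : Cn =>
    (\1_(cmap phi @` A) z * in_chart phi theta z (@std_basis R n m))%:E).

(* int_X theta for a form [theta] of top degree, where [mu] is the measure of the
   nowhere vanishing top form [vol]: theta = (theta / vol) vol. *)
Definition form_integral (p m : nat) (vol : dform p)
    (mu : {measure set (borel X) -> \bar R}) (theta : dform m) : R :=
  (\int[mu]_x (theta x (@std_basis R n m) / vol x (@std_basis R n p)))%R.

End Manifold.
Arguments wedge_pow {R n X} w m _ _.

(* Hermitian inner product on the subspace [D] of [V]. *)
Record inner_product (R : realType) (V : lmodType R[i]) (D : set V)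
    (k : V -> V -> R[i]) : Prop := InnerProduct {
  ip_linear : forall (a : R[i]) u v w, D u -> D v -> D w ->
    k (a *: u + v) w = a * k u w + k v w;
  ip_sym : forall u v, D u -> D v -> k v u = (k u v)^*;
  ip_positive : forall u, D u -> u != 0 -> 0 < k u u
}.

(* The values of a local frame outside of its domain are irrelevant. *)
Record local_frame (R : realType) (X : topologicalType) (r : nat)
    (F : X -> vectType R[i]) := LocalFrame {
  fdom : set X;
  fvec : forall x, r.-tuple (F x);
  fdom_open : open fdom;
  fvec_basis : forall x, fdom x -> basis_of fullv (fvec x)
}.

(* The holomorphic structure is given by a set of local frames with holomorphic
   transition matrices. *)
Record holo_bundle (R : realType) (n : nat) (X : complex_manifold R n)
    (r : nat) := HoloBundle {
  fiber :> X -> vectType R[i];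
  frames : set (local_frame r fiber);
  frame_at : X -> local_frame r fiber;
  frame_at_frames : forall x, frames (frame_at x);
  frame_at_dom : forall x, fdom (frame_at x) x;
  frame_compat : forall e f, frames e -> frames f -> forall i j,
    holomorphic_on (fdom e `&` fdom f)
      (fun x => coord (fvec e x) i (tnth (fvec f x) j))
}.

Section Bundle.
Context {R : realType} {n r : nat} {X : complex_manifold R n}.
Context (E : holo_bundle X r).
Local Notation C := R[i].

Definition hermitian_metric (k : forall x, E x -> E x -> C) : Prop :=
  (forall x, inner_product [set: E x] (k x)) /\
  (forall e, frames e -> forall i j, Csmooth_on (fdom e)
     (fun x => k x (tnth (fvec e x) i) (tnth (fvec e x) j))).

Definition gram_det (k : forall x, E x -> E x -> C) (x : X)
    (b : r.-tuple (E x)) : C :=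
  \det (\matrix_(i < r, j < r) k x (tnth b i) (tnth b j)).

(* det(h') / det(h); it does not depend on the basis of the fiber in which the
   two determinants are computed. *)
Definition det_ratio (h' h : forall x, E x -> E x -> C) (x : X) : R :=
  let b := fvec (frame_at E x) x in
  complex.Re (gram_det h' b / gram_det h b).

(* The Chern form (i / 2 pi) tr F_k = - (i / 2 pi) del dbar log det k
   = - (1 / 4 pi) d d^c log det k, which represents c_1(E). *)
Definition chern_form (k : forall x, E x -> E x -> C) : dform X 2 :=
  fun x v =>
    let e := frame_at E x in
    let phi := chart_at x in
    - (4 * pi)^-1 * ext_d (dc (fun z =>
        ln (complex.Re (gram_det k (fvec e (cinv phi z)))))) (cmap phi x) v.

Definition dual_section := forall x, 'Hom(E x, C^o).

Definition holomorphic_dual (s : dual_section) : Prop :=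
  forall e, frames e -> forall i,
  holomorphic_on (fdom e) (fun x => s x (tnth (fvec e x) i)).

(* The fiber of det E^* = Lambda^r E^* at [x] is the set of alternating [r]-linear
   forms on E_x. *)
Definition det_dual_fiber (x : X) : set (('I_r -> E x) -> C^o) :=
  [set f | alternating (fun (a : C) (v : E x) => a *: v) f].

Definition det_dual_section := forall x, ('I_r -> E x) -> C^o.

Definition H0_det_dual (t : det_dual_section) : Prop :=
  (forall x, det_dual_fiber (t x)) /\
  (forall e, frames e ->
     holomorphic_on (fdom e) (fun x => t x (tnth (fvec e x)))).

Definition H0_det_dual_basis (k : nat) (tau : 'I_k -> det_dual_section) : Prop :=
  [/\ forall m, H0_det_dual (tau m),
      forall a : 'I_k -> C,
        (forall x v, \sum_m a m * tau m x v = 0) -> forall m, a m = 0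
    & forall t, H0_det_dual t -> exists a : 'I_k -> C,
        forall x v, t x v = \sum_m a m * tau m x v].

(* Smoothness is tested on the frames e_1^* /\ ... /\ e_r^* of det E^*. *)
Definition det_dual_metric
    (q : forall x, (('I_r -> E x) -> C^o) -> (('I_r -> E x) -> C^o) -> C) :
    Prop :=
  (forall x, inner_product (@det_dual_fiber x) (q x)) /\
  (forall e, frames e -> Csmooth_on (fdom e) (fun x =>
     let w := wedge_covectors (fun i => coord (fvec e x) i) in q x w w)).

Definition generates_dual (N : nat) (s : 'I_N -> dual_section) : Prop :=
  forall x, <<[seq s i x | i : 'I_N]>>%VS = fullv.

(* The embedding e |-> (s_1(e), ..., s_N(e)) of the fibers of E in C^N. *)
Definition embed (N : nat) (s : 'I_N -> dual_section) (x : X) (e : E x) :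
    'cV[C]_N := \col_i s i x e.

(* The metric e |-> |f(e)|^2 for f : E -> C^N linear and injective on fibers. *)
Definition pullback_metric (N : nat) (f : forall x, E x -> 'cV[C]_N) (x : X)
    (u v : E x) : C := \sum_i f x u i 0 * (f x v i 0)^*.

End Bundle.

Definition multi_index (r N : nat) :=
  {I : {ffun 'I_r -> 'I_N} | [forall a : 'I_r, forall b : 'I_r, (a < b)%N ==> (I a < I b)%N]}.

Definition gieseker_space (R : realType) (r N k : nat) :=
  {ffun multi_index r N -> 'rV[R[i]]_k}.

Definition is_gieseker_point (R : realType) (n r N k : nat)
    (X : complex_manifold R n) (E : holo_bundle X r)
    (s : 'I_N -> dual_section E) (tau : 'I_k -> det_dual_section E)
    (T : gieseker_space R r N k) : Prop :=
  forall (I : multi_index r N) x v,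
    wedge_covectors (fun a => s (val I a) x : E x -> R[i]^o) v =
    \sum_m T I 0 m * tau m x v.

(* Lambda^r sigma acting on the multi-indices: its entries are the r x r minors
   of sigma. *)
Definition gieseker_act (R : realType) (r N k : nat) (sigma : 'M[R[i]]_N)
    (T : gieseker_space R r N k) : gieseker_space R r N k :=
  [ffun I : multi_index r N => \sum_(J : multi_index r N)
     \det (\matrix_(a < r, b < r) sigma (val I a) (val J b)) *: T J].

Section Functionals.
Context {R : realType} {n r : nat} {X : complex_manifold R n}.
Context (w : dform X 2) (mu : {measure set (borel X) -> \bar R}).
Context {E : holo_bundle X r}.
Local Notation C := R[i].

(* In what follows [mu] is the measure of omega^n. *)
Definition kahler_volume : R :=
  form_integral (wedge_pow w n) mu (wedge_pow w n).

(* c, with c_1(E) represented by the Chern form of the metric [k0] on E. *)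
Definition slope_const (k0 : forall x, E x -> E x -> C) : R :=
  2 * pi * n%:R / r%:R *
  form_integral (wedge_pow w n) mu (wedge_form (chern_form k0) (wedge_pow w n.-1)).

Definition L_functional (c : R) (h h' : forall x, E x -> E x -> C) : R :=
  c / kahler_volume * (\int[mu]_x (ln (det_ratio h' h x) / n`!%:R))%R.

(* ||a||^2; the integral and the exponential are extended real valued (log 0 is
   -oo), so that ||0|| = 0. *)
Definition gieseker_sqnorm (N k : nat)
    (q : forall x, (('I_r -> E x) -> C^o) -> (('I_r -> E x) -> C^o) -> C)
    (tau : 'I_k -> det_dual_section E) (a : gieseker_space R r N k) : R :=
  fine (expeR ((kahler_volume^-1)%:E * \int[mu]_x
    (lne (\sum_(I : multi_index r N)
       let t : ('I_r -> E x) -> C^o := fun v => \sum_m a I 0 m * tau m x v in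
       complex.Re (q x t t))%R%:E * (n`!%:R^-1)%:E)))%E.

End Functionals.

(* Main.v *)
Require Import Defs.
From mathcomp Require Import all_boot all_order all_algebra all_fingroup.
From mathcomp Require Import complex.
From mathcomp Require Import all_classical all_reals all_analysis.
From mathcomp Require Import measurable_realfun.

Set Implicit Arguments.
Unset Strict Implicit.
Unset Printing Implicit Defensive.

Import Order.TTheory GRing.Theory Num.Theory.
Import numFieldNormedType.Exports.

Local Open Scope classical_set_scope.
Local Open Scope ring_scope.

(** In a basis b of E_x let A be the N x r matrix of the embedding.  By
Cauchy-Binet, det h is the sum of the |det A_I|^2 over the r x r minors of A,
and det A_I is the value on b of s_(i_1) /\ ... /\ s_(i_r); replacing A by
sigma A replaces T by sigma T.  Since Lambda^r E_x^* is a line, passing from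
the absolute value on b to the fixed metric on det E^* multiplies all the terms
by the same positive factor, which cancels in det(h_sigma) / det(h).  So
log(det(h_sigma) / det(h)) is pointwise the difference of the integrands of
log ||sigma T||^2 and log ||T||^2.  Both integrands are continuous on the
compact X, and omega^n has locally finite mass, hence the integral of the
difference is the difference of the integrals. *)

(** * The Cauchy-Binet formula *)

(** The predicate that cuts out [multi_index], isolated so that sums can run over plain finite
    functions and be restricted afterwards. *)
Definition increasing_ffun (r N : nat) (f : {ffun 'I_r -> 'I_N}) : bool :=
  [forall a : 'I_r, forall b : 'I_r, (a < b)%N ==> (f a < f b)%N].

Lemma increasing_ffunP (r N : nat) (f : {ffun 'I_r -> 'I_N}) :
  reflect {mono f : a b / (a < b)%N} (increasing_ffun f).
Proof.
apply: (iffP forallP) => [incf a b|monof a].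
  have lt_f (c d : 'I_r) : (c < d)%N -> (f c < f d)%N.
    by move=> cd; have /forallP/(_ d)/implyP/(_ cd) := incf c.
  apply/idP/idP => [fab|]; last exact: lt_f.
  rewrite ltnNge; apply/negP; rewrite leq_eqVlt => /orP[/eqP/val_inj ba|/lt_f].
    by rewrite ba ltnn in fab.
  by move=> /ltnW; rewrite leqNgt fab.
by apply/forallP => b; apply/implyP; rewrite monof.
Qed.

(** The values of [s], listed in order, form a strictly sorted list with the same members as
    [0, ..., r-1], and a strictly sorted list is determined by its members. This makes the
    permutation that sorts an injective function unique. *)
Lemma mono_ltn_ord_eq1 (r : nat) (s : 'S_r) :
  {mono s : a b / (a < b)%N} -> s = 1%g.
Proof.
move=> ms; apply/permP => a; rewrite perm1; apply: val_inj => /=.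
have srt : sorted ltn [seq (s b : nat) | b <- enum 'I_r].
  rewrite sorted_map; have: sorted ltn (map val (enum 'I_r)).
    by rewrite val_enum_ord iota_ltn_sorted.
  by rewrite sorted_map; apply: sub_sorted => b c /=; rewrite ms.
have E : [seq (s b : nat) | b <- enum 'I_r] = [seq val b | b <- enum 'I_r].
  apply: (irr_sorted_eq ltn_trans ltnn srt).
    by rewrite val_enum_ord iota_ltn_sorted.
  move=> m; apply/mapP/mapP => [[b _ ->]|[b _ ->]].
    by exists (s b); rewrite ?mem_enum.
  by exists (s^-1 b)%g; rewrite ?mem_enum// permKV.
have := congr1 (fun l => nth 0%N l a) E.
by rewrite !(nth_map a) -?enumT ?size_enum_ord// nth_ord_enum.
Qed.

(** The permutation sends [a] to the [a]-th index in the list of all indices sorted by their value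
    under [f]; injectivity of [f] makes the inequalities strict. *)
Lemma sort_ffun (r N : nat) (f : {ffun 'I_r -> 'I_N}) : injective f ->
  exists s : 'S_r, increasing_ffun [ffun a => f (s a)].
Proof.
move=> injf.
pose l := sort (fun a b => f a <= f b)%N (enum 'I_r).
have szl : size l = r by rewrite size_sort size_enum_ord.
have injs : injective (fun a : 'I_r => nth a l a).
  move=> a b; rewrite (set_nth_default b a) ?szl// => /eqP.
  by rewrite nth_uniq ?szl// ?sort_uniq ?enum_uniq// => /eqP /val_inj.
exists (perm injs); apply/forallP => a; apply/forallP => b; apply/implyP => ab.
rewrite !ffunE !permE (set_nth_default b a) ?szl//.
rewrite ltn_neqAle; apply/andP; split.
  apply/negP => /eqP /val_inj /injf /eqP.
  by rewrite nth_uniq ?szl// ?sort_uniq ?enum_uniq// (ltn_eqF ab).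
have srt : sorted (fun a b => f a <= f b)%N l.
  by apply: sort_sorted => c d; exact: leq_total.
apply: (sorted_ltn_nth _ b srt); rewrite ?inE ?szl// => c d e.
exact: leq_trans.
Qed.

(* An injective [f] becomes increasing after precomposition with exactly one
   permutation. *)
Lemma sum_sort_ffun (M : nmodType) (r N : nat) (g : {ffun 'I_r -> 'I_N} -> M) :
  \sum_(f : {ffun 'I_r -> 'I_N} | injectiveb f) g f =
  \sum_(f | increasing_ffun f) \sum_(s : 'S_r) g [ffun a => f (s a)].
Proof.
pose act (s : 'S_r) (f : {ffun 'I_r -> 'I_N}) := [ffun a => f (s a)].
have actM s t f : act s (act t f) = act (s * t)%g f.
  by apply/ffunP => a; rewrite !ffunE permM.
have act1 f : act 1%g f = f by apply/ffunP => a; rewrite !ffunE perm1.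
have inj_act s f : injectiveb (act s f) = injectiveb f.
  apply/injectiveP/injectiveP => injf a b.
    move=> fab; apply: (@perm_inj _ s^-1%g); apply: injf.
    by rewrite !ffunE !permKV.
  by rewrite !ffunE => /injf /perm_inj.
have inc_inj f : increasing_ffun f -> injective f.
  move=> /increasing_ffunP mf a b fab; apply: val_inj.
  by case: (ltngtP a b) => //; rewrite -mf fab ltnn.
(* Each [g f] is written as a sum over the permutations that sort [f], of which there is exactly
   one. *)
transitivity (\sum_(f : {ffun 'I_r -> 'I_N} | injectiveb f)
   \sum_(s : 'S_r | increasing_ffun (act s f)) g f).
  apply: eq_bigr => f /injectiveP /sort_ffun[s incs].
  rewrite (big_pred1 s) // => t /=.
  apply/idP/eqP => [inct|->//].
  (* If [s] and [t] both sort [f], then [s * t^-1] is strictly increasing, hence the identity. *)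
  have/(congr1 (fun u => u * t)%g): (s * t^-1)%g = 1%g.
    2: by rewrite mulgKV mul1g.
  apply: mono_ltn_ord_eq1 => a b.
  have /increasing_ffunP <- := inct; rewrite !ffunE -!permM mulgKV.
  by have /increasing_ffunP <- := incs; rewrite !ffunE.
rewrite (exchange_big_dep xpredT) //= [RHS]exchange_big /=.
rewrite [RHS](reindex_inj invg_inj) /=; apply: eq_bigr => s _.
(* For fixed [s], the functions sorted by [s] are exactly the [act s^-1 f] with [f] increasing. *)
rewrite (reindex (act s^-1%g)) /=; last first.
  by exists (act s) => f _; rewrite actM ?mulgV ?mulVg act1.
apply: eq_bigl => f; rewrite inj_act actM mulgV act1 andbC.
by case: (boolP (increasing_ffun f)) => //= /inc_inj /injectiveP.
Qed.

Lemma sum_multi_index (M : nmodType) (r N : nat)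
    (g : {ffun 'I_r -> 'I_N} -> M) :
  \sum_(f | increasing_ffun f) g f = \sum_(I : multi_index r N) g (val I).
Proof.
rewrite (reindex_omap (val : multi_index r N -> _) insub) /=; last first.
  by move=> f incf; rewrite insubT.
apply: eq_bigl => I; rewrite valK eqxx andbT. exact: (valP I).
Qed.

(** Distributing the products of row sums gives a sum over all [f], with [f a] the column of [A]
    chosen in row [a]. A non-injective [f] yields a determinant with two equal rows. The injective
    ones are grouped by their increasing rearrangement, and the signs of the sorting permutations
    rebuild the minor of [A]. *)
Lemma Cauchy_Binet (K : comNzRingType) (r N : nat)
    (A : 'M[K]_(r, N)) (B : 'M[K]_(N, r)) :
  \det (A *m B) =
  \sum_(I : multi_index r N) \det (colsub (val I) A) * \det (rowsub (val I) B).
Proof.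
pose g (f : {ffun 'I_r -> 'I_N}) : K :=
  (\prod_a A a (f a)) * \det (rowsub f B).
transitivity (\sum_f g f).
  rewrite /determinant.
  under eq_bigr => s _.
    under eq_bigr do rewrite mxE.
    rewrite (bigA_distr_bigA (fun a j => A a j * B j (s a))) /= mulr_sumr.
    over.
  rewrite exchange_big /=; apply: eq_bigr => f _.
  rewrite /g mulr_sumr; apply: eq_bigr => s _.
  rewrite big_split /= mulrCA; congr (_ * (_ * _)).
  by apply: eq_bigr => a _; rewrite mxE.
rewrite (bigID (fun f : {ffun _ -> _} => injectiveb f)) /= addrC big1 ?add0r.
  rewrite sum_sort_ffun sum_multi_index; apply: eq_bigr => I _.
  rewrite [X in _ = X * _]/determinant mulr_suml; apply: eq_bigr => s _.
  rewrite /g.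
  have -> : rowsub [ffun a => val I (s a)] B = row_perm s (rowsub (val I) B).
    by apply/matrixP => a b; rewrite !mxE ffunE.
  rewrite row_permE det_mulmx det_perm mulrCA mulrA; congr (_ * _ * _).
  by apply: eq_bigr => a _; rewrite mxE ffunE.
move=> f /injectivePn[a [b ab fab]].
rewrite /g (determinant_alternate ab) ?mulr0// => c.
by rewrite !mxE fab.
Qed.

(** * Alternating forms *)

Section Alternating.
Context {K : comNzRingType} {V : lmodType K} {k : nat} (f : ('I_k -> V) -> K).
Hypothesis altf : Defs.alternating (fun (a : K) (v : V) => a *: v) f.

Lemma alternating_slotD (v : 'I_k -> V) i (u w : V) :
  f [eta v with i |-> u + w] = f [eta v with i |-> u] + f [eta v with i |-> w].
Proof. by have := altf.1 v i 1 u w; rewrite scale1r mul1r. Qed.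

Lemma alternating_slot0 (v : 'I_k -> V) i : f [eta v with i |-> 0] = 0.
Proof.
have := alternating_slotD v i 0 0; rewrite addr0 => /eqP.
by rewrite -subr_eq subrr eq_sym => /eqP.
Qed.

Lemma alternating_slotZ (v : 'I_k -> V) i a (u : V) :
  f [eta v with i |-> a *: u] = a * f [eta v with i |-> u].
Proof. by have := altf.1 v i a u 0; rewrite addr0 alternating_slot0 addr0. Qed.

Lemma alternating_slot_sum (v : 'I_k -> V) i (J : finType) (c : J -> K)
    (u : J -> V) :
  f [eta v with i |-> \sum_j c j *: u j] =
  \sum_j c j * f [eta v with i |-> u j].
Proof.
rewrite (big_morph (fun u => f [eta v with i |-> u])
  (alternating_slotD v i) (alternating_slot0 v i)).
by apply: eq_bigr => j _; rewrite alternating_slotZ.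
Qed.

(** Polarization: with all other slots fixed, [F x y] vanishes when [x = y], and expanding
    [F (x + y) (x + y) = 0] leaves [F x y + F y x = 0]. *)
Lemma alternating_tperm (v : 'I_k -> V) i j : i != j ->
  f (v \o tperm i j) = - f v.
Proof.
move=> ij; pose F (x y : V) : K := f [eta [eta v with j |-> y] with i |-> x].
have FDr x y z : F x (y + z) = F x y + F x z.
  (* Updates at distinct slots commute, which exposes slot [j] to linearity. *)
  have swap y' : [eta [eta v with j |-> y'] with i |-> x] =
      [eta [eta v with i |-> x] with j |-> y'] :> ('I_k -> V).
    apply/funext => l /=; case: eqP => [->|//].
    by rewrite (negPf ij).
  by rewrite /F !swap alternating_slotD.
have F0 x : F x x = 0.
  by apply: (altf.2 _ i j ij); rewrite /= eqxx eq_sym (negPf ij) eqxx.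
have := F0 (v i + v j).
rewrite FDr /F !alternating_slotD -/(F _ _) -/(F _ _) -/(F _ _) -/(F _ _).
rewrite !F0 add0r addr0 => /eqP; rewrite addr_eq0 => /eqP E.
have -> : f (v \o tperm i j) = F (v j) (v i).
  rewrite /F; congr f; apply/funext => l /=; case: tpermP => [->|->|].
  - by rewrite eqxx.
  - by rewrite eq_sym (negPf ij) eqxx.
  - by move=> /eqP/negPf -> /eqP/negPf ->.
have -> : f v = F (v i) (v j).
  by rewrite /F; congr f; apply/funext => l /=; have [->//|_] := eqVneq l i;
    have [->|//] := eqVneq l j.
exact: E.
Qed.

(** A permutation is a product of transpositions, each of which only changes the sign; since only
    vanishing is tracked, the sign is not recorded. *)
Lemma alternating_perm_eq0 (v : 'I_k -> V) (s : 'S_k) :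
  f v = 0 -> f (v \o s) = 0.
Proof.
move=> fv0; have [ts -> dts] := prod_tpermP s.
elim: ts dts => [_|t ts IH /= /andP[dt /IH {}IH]].
  rewrite big_nil -[RHS]fv0; congr f.
  by apply/funext => l /=; rewrite perm1.
rewrite big_cons.
have -> : v \o (tperm t.1 t.2 * \prod_(t <- ts) tperm t.1 t.2)%g =
    (v \o (\prod_(t <- ts) tperm t.1 t.2)%g) \o tperm t.1 t.2.
  by apply/funext => l /=; rewrite permM.
by rewrite alternating_tperm// IH oppr0.
Qed.

(** There are as many generators as slots: once every argument is a generator, either one is
    repeated or the arguments are a permutation of [b]. *)
Lemma alternating_generators_eq0 (b : 'I_k -> V) :
  (forall u, exists c : 'I_k -> K, u = \sum_i c i *: b i) ->
  f b = 0 -> forall v, f v = 0.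
Proof.
move=> genb fb0 v.
(* Induction on the number m of slots that may hold a non-generator. *)
have H m : (m <= k)%N -> forall v : 'I_k -> V,
    (forall j : 'I_k, (m <= j)%N -> exists i, v j = b i) -> f v = 0.
  elim: m => [_|m IH mk] {}v vb.
    have [g vg] := fin_all_exists (fun j => vb j (leq0n j)).
    have [/injectiveP injg|/injectivePn[i [j ij gij]]] :=
      boolP (injectiveb g); last by apply: (altf.2 _ i j ij); rewrite !vg gij.
    have -> : v = b \o perm injg by apply/funext => j /=; rewrite permE vg.
    exact: alternating_perm_eq0.
  pose i := Ordinal mk.
  have [c vi] := genb (v i).
  have -> : v = [eta v with i |-> \sum_l c l *: b l].
    by apply/funext => l /=; case: eqP => [->|].
  rewrite alternating_slot_sum big1// => l _.
  rewrite (IH (ltnW mk)) ?mulr0// => j mj /=.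
  case: eqP => [_|/eqP ji]; first by exists l.
  by apply: vb; rewrite ltn_neqAle mj andbT eq_sym; exact: ji.
by apply: (H k) => // j; rewrite leqNgt ltn_ord.
Qed.

End Alternating.

Lemma alternatingDZ (K : comNzRingType) (V : lmodType K) (k : nat) (a : K)
    (f g : ('I_k -> V) -> K) :
  Defs.alternating (fun (a : K) (v : V) => a *: v) f ->
  Defs.alternating (fun (a : K) (v : V) => a *: v) g ->
  Defs.alternating (fun (a : K) (v : V) => a *: v) (fun v => a * f v + g v).
Proof.
move=> [f1 f2] [g1 g2]; split=> [v i c u w|v i j ij vij].
  by rewrite f1 g1 !mulrDr mulrCA addrACA.
by rewrite (f2 v i j) ?(g2 v i j)// mulr0 addr0.
Qed.

Lemma alternating0 (K : comNzRingType) (V : lmodType K) (k : nat) :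
  Defs.alternating (fun (a : K) (v : V) => a *: v) (fun _ : 'I_k -> V => 0).
Proof. by split=> // *; rewrite mulr0 addr0. Qed.

Lemma alternating_sum (K : comNzRingType) (V : lmodType K) (k m : nat)
    (a : 'I_m -> K) (f : 'I_m -> ('I_k -> V) -> K) :
  (forall i, Defs.alternating (fun (a : K) (v : V) => a *: v) (f i)) ->
  Defs.alternating (fun (a : K) (v : V) => a *: v) (fun v => \sum_i a i * f i v).
Proof.
move=> altf; split=> [v i c u w|v i j ij vij].
  rewrite mulr_sumr -big_split; apply: eq_bigr => l _ /=.
  by rewrite (altf l).1 mulrDr mulrCA.
by rewrite big1// => l _; rewrite ((altf l).2 v i j) ?mulr0.
Qed.

Lemma alternating_wedge_covectors (K : comNzRingType) (V : lmodType K) (k : nat)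
    (l : 'I_k -> V -> K) :
  (forall a c u w, l a (c *: u + w) = c * l a u + l a w) ->
  Defs.alternating (fun (a : K) (v : V) => a *: v) (wedge_covectors l).
Proof.
move=> linl; split=> [v i c u w|v i j ij vij].
  (* The slots of [v] index columns; transposing turns them into rows, where linearity of the
     determinant applies. *)
  rewrite /wedge_covectors -det_tr.
  rewrite (determinant_multilinear (i0 := i)
    (B := (\matrix_(a, b) l a ([eta v with i |-> u] b))^T)
    (C := (\matrix_(a, b) l a ([eta v with i |-> w] b))^T) (b := c) (c := 1)).
  - by rewrite !det_tr mul1r.
  - by apply/rowP => a; rewrite !mxE /= eqxx linl mul1r.
  - by apply/matrixP => a d; rewrite !mxE /= eq_sym (negPf (neq_lift _ _)).
  - by apply/matrixP => a d; rewrite !mxE /= eq_sym (negPf (neq_lift _ _)).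
rewrite /wedge_covectors -det_tr (determinant_alternate ij)// => a.
by rewrite !mxE vij.
Qed.

(** * Top-degree alternating forms in a basis *)

Section AlternatingBasis.
Context {K : fieldType} {V : vectType K} {r : nat} (b : r.-tuple V).
Hypothesis basisb : basis_of fullv b.

Lemma wedge_coord_basis :
  wedge_covectors (fun i => coord b i) (tnth b) = 1.
Proof.
rewrite /wedge_covectors -[RHS](det1 K r); congr determinant.
apply/matrixP => i j; rewrite !mxE (tnth_nth 0) coord_free ?(basis_free basisb)//.
by rewrite eq_sym.
Qed.

Lemma alternating_wedge_coord :
  Defs.alternating (fun (a : K) (v : V) => a *: v)
    (wedge_covectors (fun i => coord b i)).
Proof. by apply: alternating_wedge_covectors => a c u w; rewrite linearP. Qed.

(** The top exterior power of the dual is a line: [f] minus its value on [b] times the wedge of the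
    coordinates vanishes on [b], hence everywhere. *)
Lemma alternating_eq_wedge (f : ('I_r -> V) -> K) :
  Defs.alternating (fun (a : K) (v : V) => a *: v) f ->
  f = (fun v => f (tnth b) * wedge_covectors (fun i => coord b i) v).
Proof.
move=> altf; apply/funext => v.
have altg := alternatingDZ (- f (tnth b)) alternating_wedge_coord altf.
have gen u : exists c : 'I_r -> K, u = \sum_i c i *: tnth b i.
  exists (fun i => coord b i u); under eq_bigr do rewrite (tnth_nth 0).
  by apply: coord_basis basisb _; exact: memvf.
have := alternating_generators_eq0 altg gen.
rewrite wedge_coord_basis mulr1 addNr => /(_ erefl v) /eqP.
by rewrite mulNr addrC subr_eq0 => /eqP.
Qed.

End AlternatingBasis.

Local Open Scope complex_scope.

(** * Integration *)

(* For integrals defined as suprema over simple functions below, monotonicity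
   needs no measurability; so the slices of the iterated integral below need
   not be known to be measurable. *)
Lemma le_integral_no_measurability d (T : measurableType d) (R : realType)
    (mu : {measure set T -> \bar R}) (f g : T -> \bar R) :
  (forall x, f x <= g x)%E -> (\int[mu]_x f x <= \int[mu]_x g x)%E.
Proof.
have ge0 (a b : T -> \bar R) : (forall x, 0 <= a x)%E -> (forall x, a x <= b x)%E ->
    (\int[mu]_x a x <= \int[mu]_x b x)%E.
  move=> a0 ab.
  have b0 x : (0 <= b x)%E by exact: le_trans (ab x).
  rewrite !ge0_integralTE//.
  apply: ereal_sup_le => _ [h ha <-]; exists h => // x /=.
  exact: le_trans (ab x).
move=> fg; rewrite [leLHS]integralE [leRHS]integralE.
apply: leeB; apply: ge0 => // x.
- by rewrite !funeposE ge_max !le_max fg lexx orbT.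
- by rewrite !funenegE ge_max !le_max leeN2 fg lexx orbT.
Qed.

(** Comparison with [B] times the indicator of [[-K, K]], an interval of length [2 * K]; [f] need
    not be measurable, as it will itself be an iterated integral. *)
Lemma integral_le_box (R : realType) (B K : R) (f : R -> \bar R) :
  0 <= B -> 0 <= K -> (forall x, f x <= B%:E)%E ->
  (forall x, K < `|x| -> (f x <= 0)%E) ->
  (\int[lebesgue_measure]_x f x <= (B * (2 * K))%:E)%E.
Proof.
move=> B0 K0 fB f0.
apply: (@le_trans _ _ (\int[@lebesgue_measure R]_x
    (B%:E * (\1_(`[- K, K]%classic) x)%:E))%E).
  apply: le_integral_no_measurability => x.
  rewrite indicE; have [xK|] := boolP (x \in _); first by rewrite mule1.
  rewrite mule0 notin_setE /= in_itv /= -ler_norml => /negP.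
  by rewrite -ltNge; exact: f0.
rewrite ge0_integralZl//; last first.
  by apply/measurable_EFinP; exact: measurable_indic.
rewrite integral_indic// setIT.
rewrite [X in (_ * X)%E](lebesgue_measure_itv `[- K, K]%R) /= lte_fin.
case: ifP => _; last by rewrite mule0 lee_fin !mulr_ge0.
by rewrite -EFinD -EFinM lee_fin opprK mulr_natl mulr2n.
Qed.

(** Supremum times the volume of a box of side [2 * K] in real dimension [2n]. Each induction step
    peels off one complex coordinate, that is, two real integrals. *)
Lemma lebesgue_intC_le (R : realType) (n : nat) (F : 'rV[R[i]]_n -> \bar R)
    (M K : R) : 0 <= M -> 0 <= K ->
  (forall z, F z <= M%:E)%E ->
  (forall (z : 'rV[R[i]]_n) l,
     K < `|complex.Re (z 0 l)| \/ K < `|complex.Im (z 0 l)| ->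
     (F z <= 0)%E) ->
  (lebesgue_intC F <= (M * (2 * K) ^+ (n.*2))%:E)%E.
Proof.
elim: n F M => [|n IH] F M M0 K0 FM F0 /=; first by rewrite expr0 mulr1.
have -> : M * (2 * K) ^+ n.+1.*2 = M * (2 * K) ^+ n.*2 * (2 * K) * (2 * K).
  by rewrite doubleS !exprSr !mulrA.
have pow_ge0 : 0 <= (2 * K) ^+ n.*2 by rewrite exprn_ge0// mulr_ge0.
have step (x y : R) (M' : R) : 0 <= M' ->
    (forall z, F (row_mx (x +i* y)%:M z) <= M'%:E)%E ->
    (lebesgue_intC (fun z : 'rV[R[i]]_n => F (row_mx (x +i* y)%:M z))
      <= (M' * (2 * K) ^+ n.*2)%:E)%E.
  move=> M'0 FM'; apply: IH => // z l zl.
  apply: (F0 _ (rshift 1 l)).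
  by have -> : row_mx (x +i* y)%:M z 0 (rshift 1 l) = z 0 l by exact: row_mxEr.
(* When the first coordinate is already outside the box, [step] applies to the whole slice with the
   bound [0]. *)
have le0 x y : K < `|x| \/ K < `|y| ->
    (lebesgue_intC (fun z : 'rV[R[i]]_n => F (row_mx (x +i* y)%:M z)) <= 0)%E.
  move=> xy; have := step x y 0 (lexx _); rewrite mul0r; apply => z.
  apply: (F0 (row_mx (x +i* y)%:M z) (lshift n (0 : 'I_1))).
  have -> : row_mx (x +i* y)%:M z 0 (lshift n 0) = x +i* y.
    by rewrite [LHS]row_mxEl mxE.
  by [].
apply: integral_le_box => // [|x|x xK].
- by rewrite !mulr_ge0.
- apply: integral_le_box => // [|y|y yK]; first by rewrite mulr_ge0.
    exact: step.
  by apply: le0; right.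
have := @integral_le_box R 0 K _ (lexx _) K0; rewrite mul0r; apply => y.
  by apply: le0; left.
by move=> _; apply: le0; left.
Qed.

(** * Integrability of continuous functions on a compact space *)

Lemma compact_measure_lty (R : realType) (X : ptopologicalType)
    (mu : {measure set (borel X) -> \bar R}) :
  compact [set: X] ->
  (forall x, exists U : set X, [/\ open U, U x & (mu U < +oo)%E]) ->
  (mu setT < +oo)%E.
Proof.
move=> cX finU.
have [U HU] := choice finU.
have oU x : open (U x) by have [] := HU x.
move: cX; rewrite compact_cover => /(_ X setT U) [||D _ covD].
- by move=> x _; exact: oU.
- by move=> x _; exists x => //; have [] := HU x.
have mU x : measurable (U x : set (borel X)) by exact: sub_sigma_algebra.
have finD (l : seq X) : (mu (\big[setU/set0]_(x <- l) U x) < +oo)%E.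
  elim: l => [|x l IH]; first by rewrite big_nil measure0.
  rewrite big_cons; apply: (le_lt_trans (measureU2 _ _ _)) => //.
    by apply: bigsetU_measurable => y _; exact: mU.
  by rewrite lte_add_pinfty//; have [] := HU x.
apply: (le_lt_trans _ (finD (finmap.enum_fset D))).
apply: le_measure; rewrite ?inE//.
  by apply: bigsetU_measurable => y _; exact: mU.
by rewrite -bigcup_seq => x /covD.
Qed.

Lemma continuous_borel_measurable (R : realType) (X : ptopologicalType)
    (f : X -> R) : continuous f ->
  measurable_fun [set: borel X] (f : borel X -> R).
Proof.
move=> cf; apply: (measurability _ (RGenOInfty.measurableE R)) => _ [_ [a ->] <-].
rewrite setTI; apply: sub_sigma_algebra.
by move/continuousP: cf; apply; exact: interval_open.
Qed.

Lemma integrable_continuous_borel (R : realType) (X : ptopologicalType)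
    (mu : {measure set (borel X) -> \bar R}) (f : X -> R) :
  compact [set: X] -> (mu setT < +oo)%E -> continuous f ->
  mu.-integrable [set: borel X] (EFin \o f).
Proof.
move=> cX mufin cf; apply: measurable_bounded_integrable => //.
  exact: continuous_borel_measurable.
have : bounded_set (f @` setT : set R^o).
  apply: compact_bounded; apply: continuous_compact => //.
  exact: continuous_subspaceT.
rewrite /bounded_set /bounded_near.
by apply: filterS => M fM x _; apply: fM; exists x.
Qed.

(** * Minors and Gieseker points in a fiber *)

Section FiberAlgebra.
Context {R : realType} {n r : nat} {X : complex_manifold R n}.
Context {E : holo_bundle X r}.
Local Notation C := R[i].

(** The squared modulus as an element of [R]; the norm of [R[i]] takes its values in [R[i]]. *)
Definition sqmod (z : C) : R := complex.Re z ^+ 2 + complex.Im z ^+ 2.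

Lemma sqmodE (z : C) : (sqmod z)%:C = z * z^*.
Proof. by rewrite -sqr_normc -add_Re2_Im2. Qed.

Lemma sqmod_ge0 z : 0 <= sqmod z.
Proof. by rewrite addr_ge0 ?sqr_ge0. Qed.

Lemma sqmod_gt0 z : z != 0 -> 0 < sqmod z.
Proof.
move=> z0; rewrite lt_neqAle sqmod_ge0 andbT eq_sym.
apply: contra z0 => /eqP s0; apply/eqP.
have := sqmodE z; rewrite s0 => /esym/eqP; rewrite mulf_eq0 conjc_eq0 orbb.
by move/eqP.
Qed.

Definition frame_matrix (N : nat) (f : forall x, E x -> 'cV[C]_N) x
    (b : r.-tuple (E x)) : 'M[C]_(N, r) :=
  \matrix_(i, j) f x (tnth b j) i 0.

(** The Gram matrix is the product of the transpose of [A] and the conjugate of [A], and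
    Cauchy-Binet pairs each minor with its own conjugate. *)
Lemma gram_det_pullback (N : nat) (f : forall x, E x -> 'cV[C]_N) x
    (b : r.-tuple (E x)) :
  gram_det (pullback_metric f) b =
  (\sum_(I : multi_index r N) sqmod (\det (rowsub (val I) (frame_matrix f b))))%:C.
Proof.
set A := frame_matrix f b.
transitivity (\det (A^T *m map_mx (@conjc R) A)).
  congr determinant; apply/matrixP => i j; rewrite !mxE.
  by apply: eq_bigr => l _; rewrite !mxE.
rewrite Cauchy_Binet rmorph_sum; apply: eq_bigr => I _ /=.
rewrite sqmodE -(det_map_mx (@conjc R)); congr (_ * _); last first.
  by congr determinant; apply/matrixP => i j; rewrite !mxE.
by rewrite -det_tr; congr determinant; apply/matrixP => i j; rewrite !mxE.
Qed.

(** If all maximal minors of [A] vanished, Cauchy-Binet for [B *m A] would give [1 = 0]. *)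
Lemma exists_minor_neq0 (K : fieldType) (N : nat) (A : 'M[K]_(N, r))
    (B : 'M[K]_(r, N)) :
  B *m A = 1%:M -> exists I : multi_index r N, \det (rowsub (val I) A) != 0.
Proof.
move=> BA1; apply/existsP; apply: contraT; rewrite negb_exists => /forallP d0.
have := Cauchy_Binet B A; rewrite BA1 det1 big1 => [/eqP|I _].
  by rewrite oner_eq0.
by have := d0 I; rewrite negbK => /eqP ->; rewrite mulr0.
Qed.

(** A row in the left kernel of the transpose of [A] lists the coordinates of a vector [e] killed by
    every [s i x]. These span the dual fiber, so the coordinate forms kill [e] as well, and
    [e = 0]. *)
Lemma generates_left_inverse (N : nat) (s : 'I_N -> dual_section E) x
    (b : r.-tuple (E x)) :
  generates_dual s -> basis_of fullv b ->
  exists B, B *m frame_matrix (embed s) b = 1%:M.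
Proof.
move=> gens basisb; set A := frame_matrix _ _.
suff /row_freeP[B AB] : row_free A^T.
  by exists B^T; rewrite -[LHS]trmxK trmx_mul trmxK AB trmx1.
rewrite -kermx_eq0; apply/rowV0P => u /sub_kermxP uA.
pose e := \sum_j u 0 j *: tnth b j.
have se0 i : s i x e = 0.
  rewrite linear_sum; have := congr1 (fun M : 'rV_N => M 0 i) uA.
  rewrite !mxE => E0; rewrite -[RHS]E0; apply: eq_bigr => j _.
  by rewrite linearZ !mxE.
have le0 (l : 'Hom(E x, C^o)) : l e = 0.
  have : l \in <<[seq s i x | i : 'I_N]>>%VS by rewrite gens memvf.
  move=> /(@coord_span _ _ _ (in_tuple _)) ->.
  rewrite sum_lfunE big1// => i _; rewrite scale_lfunE.
  have /mapP[j _ ->] : (in_tuple [seq s i x | i : 'I_N])`_i \in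
      [seq s i x | i : 'I_N] by rewrite mem_nth.
  by rewrite se0 scaler0.
apply/rowP => j; rewrite mxE.
have := le0 (linfun (coord b j : E x -> C^o)).
rewrite lfunE /= linear_sum (bigD1 j)//= big1 ?addr0.
  by rewrite linearZ /= (tnth_nth 0) coord_free ?(basis_free basisb)// eqxx mulr1.
move=> i ij; rewrite linearZ /= (tnth_nth 0) coord_free ?(basis_free basisb)//.
by rewrite (negPf ij) mulr0.
Qed.

Lemma frame_matrix_mulmx (N : nat) (sigma : 'M[C]_N)
    (f : forall x, E x -> 'cV[C]_N) x (b : r.-tuple (E x)) :
  frame_matrix (fun x e => sigma *m f x e) b = sigma *m frame_matrix f b.
Proof.
by apply/matrixP => i j; rewrite !mxE; apply: eq_bigr => l _; rewrite mxE.
Qed.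

Section Gieseker.
Context {N k : nat} (tau : 'I_k -> det_dual_section E).

(** The section of [det E^*] encoded by the entry [I] of [a]; for the Gieseker point it is the wedge
    of the [s i] with [i] in [I]. *)
Definition gieseker_form (a : gieseker_space R r N k) (I : multi_index r N) x
    (v : 'I_r -> E x) : C := \sum_m a I 0 m * tau m v.

Lemma alternating_gieseker_form a I x :
  (forall m, det_dual_fiber (@tau m x)) ->
  Defs.alternating (fun (c : C) (v : E x) => c *: v) (@gieseker_form a I x).
Proof. exact: alternating_sum. Qed.

(** For the Gieseker point this is the Gram determinant of [h] in the basis [b]. *)
Definition frame_sqnorm (a : gieseker_space R r N k) x (b : r.-tuple (E x)) : R :=
  \sum_(I : multi_index r N) sqmod (gieseker_form a I (tnth b)).

Lemma gieseker_form_act a sigma I x (v : 'I_r -> E x) :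
  gieseker_form (gieseker_act sigma a) I v =
  \sum_(J : multi_index r N)
    \det (mxsub (val I) (val J) sigma) * gieseker_form a J v.
Proof.
rewrite /gieseker_form; under eq_bigr => m _.
  rewrite ffunE summxE mulr_suml; under eq_bigr do rewrite mxE -mulrA; over.
by rewrite exchange_big /=; apply: eq_bigr => J _; rewrite mulr_sumr.
Qed.

Lemma gieseker_form_embed (s : 'I_N -> dual_section E)
    (T : gieseker_space R r N k) I x (b : r.-tuple (E x)) :
  is_gieseker_point s tau T ->
  gieseker_form T I (tnth b) = \det (rowsub (val I) (frame_matrix (embed s) b)).
Proof.
move=> gT; rewrite /gieseker_form -(gT I x); congr determinant.
by apply/matrixP => i j; rewrite !mxE.
Qed.

(** Functoriality of the exterior power: the action by the minors of [sigma] replaces [A] by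
    [sigma *m A], by Cauchy-Binet for the rows [I] of [sigma] times [A]. *)
Lemma gieseker_form_act_embed (s : 'I_N -> dual_section E)
    (T : gieseker_space R r N k) (sigma : 'M[C]_N) I x (b : r.-tuple (E x)) :
  is_gieseker_point s tau T ->
  gieseker_form (gieseker_act sigma T) I (tnth b) =
  \det (rowsub (val I) (sigma *m frame_matrix (embed s) b)).
Proof.
move=> gT; rewrite gieseker_form_act -mul_rowsub_mx Cauchy_Binet.
apply: eq_bigr => J _; rewrite (gieseker_form_embed _ _ gT); congr (\det _ * _).
by apply/matrixP => i j; rewrite !mxE.
Qed.

Lemma frame_sqnorm_gt0 a x (b : r.-tuple (E x)) (A : 'M[C]_(N, r)) B :
  (forall I, gieseker_form a I (tnth b) = \det (rowsub (val I) A)) ->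
  B *m A = 1%:M -> 0 < frame_sqnorm a b.
Proof.
move=> aA /exists_minor_neq0[I dI]; rewrite /frame_sqnorm (bigD1 I)//=.
by rewrite ltr_pwDl ?sqmod_gt0 ?aA// sumr_ge0// => J _; exact: sqmod_ge0.
Qed.

End Gieseker.
End FiberAlgebra.

(** * Continuity and local finiteness *)

Lemma normc_ge_Im (R : rcfType) (z : R[i]) : `|complex.Im z|%:C <= `|z|.
Proof.
rewrite -normrN -ReiNIm (le_trans (normc_ge_Re _))// normrM.
have -> : `|'i : R[i]| = 1 by rewrite normc_def /= expr0n expr1n add0r sqrtr1.
by rewrite mulr1.
Qed.

Lemma continuous_Re (R : realType) : continuous (@complex.Re R).
Proof.
move=> z A /nbhs_ballP[e e0 eA]; exists e%:C => [|y zy]; first by rewrite /= ltcR.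
apply: eA; rewrite -ball_normE /= -raddfB -ltcR; apply: le_lt_trans zy.
exact: normc_ge_Re.
Qed.

Lemma continuous_Im (R : realType) : continuous (@complex.Im R).
Proof.
move=> z A /nbhs_ballP[e e0 eA]; exists e%:C => [|y zy]; first by rewrite /= ltcR.
apply: eA; rewrite -ball_normE /= -raddfB -ltcR; apply: le_lt_trans zy.
exact: normc_ge_Im.
Qed.

Section ContinuousAt.
Context {R : numFieldType} {T : topologicalType} (x : T).
Implicit Types f g : T -> R.

Lemma continuous_at_cst (c : R) : {for x, continuous (fun _ : T => c)}.
Proof. exact: (@cst_continuous T R c x). Qed.

Lemma continuous_at_near f g : (\forall y \near x, f y = g y) ->
  {for x, continuous f} -> {for x, continuous g}.
Proof.
move=> fg; rewrite /prop_for /continuous_at (nbhs_singleton fg).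
by apply: cvg_trans; exact: near_eq_cvg.
Qed.

Lemma continuous_atM f g : {for x, continuous f} -> {for x, continuous g} ->
  {for x, continuous (fun y => f y * g y)}.
Proof. exact: continuousM. Qed.

Lemma continuous_atD f g : {for x, continuous f} -> {for x, continuous g} ->
  {for x, continuous (fun y => f y + g y)}.
Proof. exact: continuousD. Qed.

Lemma continuous_at_sum (I : finType) (f : I -> T -> R) :
  (forall i, {for x, continuous (f i)}) ->
  {for x, continuous (fun y => \sum_i f i y)}.
Proof.
move=> cf; elim: (index_enum I) => [|i r IH].
  rewrite /prop_for; under [X in continuous_at _ X]eq_fun do rewrite big_nil.
  exact: continuous_at_cst.
rewrite /prop_for; under [X in continuous_at _ X]eq_fun do rewrite big_cons.
exact: continuous_atD.
Qed.

End ContinuousAt.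

(** On the open domain of the chart, [f] is [f \o cinv phi] composed with the continuous map
    [cmap phi]. *)
Lemma chart_continuous_at (R : realType) (n : nat) (T U : topologicalType)
    (f : T -> U) (phi : chart R n T) x :
  cdom phi x -> {for cmap phi x, continuous (f \o cinv phi)} ->
  {for x, continuous f}.
Proof.
move=> phix cf A fxA.
have fA : nbhs (cmap phi x) ((f \o cinv phi) @^-1` A).
  by apply: cf; rewrite /= cmapK.
have dx : nbhs x (cdom phi).
  exact: (open_nbhs_nbhs (conj (@cdom_open _ _ _ phi) phix)).
have cA : nbhs x (cmap phi @^-1` ((f \o cinv phi) @^-1` A)).
  exact: (cmap_continuous phix fA).
suff: nbhs x (f @^-1` A) by [].
have H : nbhs x ((cmap phi @^-1` ((f \o cinv phi) @^-1` A)) `&` cdom phi).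
  exact: filterI.
apply: filterS H => y [/= fy phiy].
by rewrite /= -(cmapK phiy).
Qed.

Section Charts.
Context {R : realType} {n : nat} (X : complex_manifold R n).
Local Notation C := R[i].
Local Notation Cn := 'rV[C]_n.

Lemma holomorphic_on_continuous (U : set X) (g : X -> C) x :
  open U -> U x -> holomorphic_on U g -> {for x, continuous g}.
Proof.
move=> oU Ux hg; have dx := chart_at_dom x.
apply: (chart_continuous_at dx).
exact: (differentiable_continuous (hg _ (chart_at_atlas x) x Ux dx)).
Qed.

Lemma smooth_on_continuous (U : set X) (g : X -> R) x :
  U x -> smooth_on U g -> {for x, continuous g}.
Proof.
move=> Ux sg; have dx := chart_at_dom x.
apply: (chart_continuous_at dx).
by have [+ _] := sg _ (chart_at_atlas x) 0%N; apply; exists x.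
Qed.

(** [in_chart] only substitutes tangent vectors, so it commutes with wedge products, and the
    coefficients of the power are polynomials in those of [w]. *)
Lemma in_chart_wedge_pow_continuous (w : dform X 2) phi (z : Cn) m :
  (forall v, {for z, continuous (fun y => in_chart phi w y v)}) ->
  forall v, {for z, continuous (fun y => in_chart phi (wedge_pow w m) y v)}.
Proof.
move=> cw; elim: m => [|m IH] v; first exact: (@cst_continuous _ R 1).
apply: continuous_atM; first exact: continuous_at_cst.
apply: continuous_at_sum => s.
apply: continuous_atM; last exact: IH.
by apply: continuous_atM; [exact: continuous_at_cst|exact: cw].
Qed.

(** Around [x] a neighbourhood [U] is chosen inside a chart, where the density [g] is below [M] and
    all real coordinates are below [K] in absolute value; then the mass of [U] is at most
    [M * (2 * K) ^+ n.*2]. *)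
Lemma measure_of_form_locally_finite (m : nat) (theta : dform X m)
    (mu : {measure set (borel X) -> \bar R}) :
  measure_of_form theta mu ->
  (forall phi, atlas phi -> forall z v, (cmap phi @` cdom phi) z ->
     {for z, continuous (fun y => in_chart phi theta y v)}) ->
  forall x, exists U : set X, [/\ open U, U x & (mu U < +oo)%E].
Proof.
move=> mu_theta ctheta x.
pose phi := chart_at x; have ax := chart_at_atlas x; have dx := chart_at_dom x.
pose z0 := cmap phi x.
pose g z := in_chart phi theta z (@std_basis R n m).
(* The added [1] here and in [K] makes the bounds strict at [z0], so that they persist nearby by
   continuity. *)
pose M := `|g z0| + 1.
pose K := 1 + \sum_l (`|complex.Re (z0 0 l)| + `|complex.Im (z0 0 l)|).
have cg : {for z0, continuous g} by apply: ctheta => //; exists x.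
have near_g : \forall z \near z0, g z < M.
  have /cvgr_lt := cg; apply.
  by rewrite /M (le_lt_trans (ler_norm _))// ltrDl.
have near_box l : \forall z \near z0,
    `|complex.Re ((z : Cn) 0 l)| < K /\ `|complex.Im (z 0 l)| < K.
  have cl := @coord_continuous C 1 n 0 l z0.
  have lt_re : `|complex.Re (z0 0 l)| + `|complex.Im (z0 0 l)| < K.
    rewrite /K (bigD1 l)//= addrCA ltrDl ltr_pwDl//.
    by apply: sumr_ge0 => i _; exact: addr_ge0.
  have near_lt (h : C -> R) : continuous h -> `|h (z0 0 l)| < K ->
      \forall z \near z0, `|h ((z : Cn) 0 l)| < K.
    move=> ch hK; have /cvg_norm/cvgr_lt := continuous_comp cl (ch _).
    exact.
  near=> z; split; near: z; apply: near_lt.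
  - exact: continuous_Re.
  - by apply: le_lt_trans lt_re; rewrite lerDl.
  - exact: continuous_Im.
  - by apply: le_lt_trans lt_re; rewrite lerDr.
have near_boxes : \forall z \near z0, forall l,
    `|complex.Re ((z : Cn) 0 l)| < K /\ `|complex.Im (z 0 l)| < K.
  by apply: (@filter_forall _ _ _ (nbhs z0)) => l; exact: near_box.
have nearU : \forall y \near x, cdom phi y /\ g (cmap phi y) < M /\ (forall l,
    `|complex.Re (cmap phi y 0 l)| < K /\ `|complex.Im (cmap phi y 0 l)| < K).
  near=> y; split; [|split]; near: y.
  - exact: (open_nbhs_nbhs (conj (@cdom_open _ _ _ phi) dx)).
  - exact: (cmap_continuous dx near_g).
  - exact: (cmap_continuous dx near_boxes).
have := nearU; rewrite /prop_near1 nbhsE => -[U [oU Ux] UP].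
exists U; split => //.
rewrite (mu_theta _ ax); last 2 first.
- exact: sub_sigma_algebra.
- by move=> y /UP[].
have K0 : 0 <= K by rewrite /K addr_ge0// sumr_ge0// => i _; rewrite addr_ge0.
have M0 : 0 <= M by rewrite /M addr_ge0.
apply: le_lt_trans (lebesgue_intC_le M0 K0 _ _) _; last by rewrite ltry.
- move=> z; rewrite lee_fin indicE.
  have [|_] := boolP (z \in _); last by rewrite mul0r.
  by rewrite inE mul1r => -[y /UP[_ [gy _]] <-]; exact: ltW.
- move=> z l zl; rewrite lee_fin indicE.
  have [|_] := boolP (z \in _); last by rewrite mul0r.
  rewrite inE => -[y /UP[_ [_ /(_ l)[re im]]] yz]; move: zl; rewrite -yz.
  by rewrite !ltNge (ltW re) (ltW im) => -[].
Unshelve. all: by end_near. Qed.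

Lemma kahler_measure_locally_finite (w : dform X 2)
    (mu : {measure set (borel X) -> \bar R}) :
  kahler_form w -> measure_of_form (wedge_pow w n) mu ->
  forall x, exists U : set X, [/\ open U, U x & (mu U < +oo)%E].
Proof.
move=> kw mw; apply: (measure_of_form_locally_finite mw) => phi aphi z v dz.
apply: in_chart_wedge_pow_continuous => {}v.
by have [+ _] := kahler_smooth kw aphi v 0%N; apply.
Qed.

End Charts.

(** * The integrand of the Gieseker norm *)

Section DetMetric.
Context {R : realType} {n r : nat} {X : complex_manifold R n}.
Context {E : holo_bundle X r}.
Local Notation C := R[i].

Section Fiber.
Context {x : X} (b : r.-tuple (E x)) (basisb : basis_of fullv b).
Context (q : (('I_r -> E x) -> C^o) -> (('I_r -> E x) -> C^o) -> C).
Hypothesis ipq : inner_product (@det_dual_fiber _ _ _ _ E x) q.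
Let w : ('I_r -> E x) -> C^o := wedge_covectors (fun i => coord b i).

Let Dw : det_dual_fiber w.
Proof. exact: alternating_wedge_coord. Qed.

Lemma det_metric_wedge_gt0 : 0 < q w w.
Proof.
apply: (ip_positive ipq) => //; apply/eqP => w0.
have : w (tnth b) = 1 by exact: wedge_coord_basis.
by rewrite w0 => /esym/eqP; rewrite oner_eq0.
Qed.

(** [t] is the multiple [t (tnth b)] of [w], and [q] is sesquilinear. *)
Lemma det_metric_sqmod t : det_dual_fiber t ->
  complex.Re (q t t) = complex.Re (q w w) * sqmod (t (tnth b)).
Proof.
move=> Dt; pose a : C := t (tnth b).
have tE : t = a *: w.
  have tE := alternating_eq_wedge basisb Dt.
  by etransitivity; first exact: tE.
have D0 : det_dual_fiber (0 : ('I_r -> E x) -> C^o) by exact: alternating0.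
(* Linearity is given for [a *: u + v]; taking [v = 0] to extract scalars requires this value
   first. *)
have q0 u : det_dual_fiber u -> q 0 u = 0.
  move=> Du; have := ip_linear ipq 1 D0 D0 Du.
  rewrite scale1r addr0 mul1r => /eqP; rewrite -subr_eq subrr eq_sym.
  by move/eqP.
have qZ u : det_dual_fiber u -> q t u = a * q w u.
  by move=> Du; rewrite tE -[a *: w]addr0 (ip_linear ipq)// q0// addr0.
rewrite qZ// (ip_sym ipq Dt Dw) qZ// rmorphM /= -(ip_sym ipq Dw Dw) mulrA.
rewrite -sqmodE -/a.
by case: (q w w) => u v /=; rewrite mul0r subr0 mulrC.
Qed.

End Fiber.

Context {N k : nat} (tau : 'I_k -> det_dual_section E).
Context (q : forall x, (('I_r -> E x) -> C^o) -> (('I_r -> E x) -> C^o) -> C).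
Arguments q : clear implicits.

(** The argument of the logarithm in [gieseker_sqnorm]. *)
Definition gieseker_density (a : gieseker_space R r N k) (x : X) : R :=
  \sum_(I : multi_index r N)
    complex.Re (q x (@gieseker_form _ _ _ _ _ _ _ tau a I x)
                    (@gieseker_form _ _ _ _ _ _ _ tau a I x)).

Let w (e : local_frame r E) x : ('I_r -> E x) -> C^o :=
  wedge_covectors (fun i => coord (fvec e x) i).
Arguments w : clear implicits.

Hypothesis q_metric : det_dual_metric q.
Hypothesis tau_H0 : forall m, H0_det_dual (tau m).

(** The first factor on the right does not depend on [a]; it is the factor that cancels between [T]
    and its image under [sigma]. *)
Lemma gieseker_densityE a (e : local_frame r E) x : fdom e x ->
  gieseker_density a x =
  complex.Re (q x (w e x) (w e x)) * frame_sqnorm tau a (fvec e x).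
Proof.
move=> ex; rewrite mulr_sumr; apply: eq_bigr => I _.
apply: (det_metric_sqmod (fvec_basis ex)); first exact: q_metric.1.
by apply: alternating_gieseker_form => m; exact: (tau_H0 m).1.
Qed.

Lemma continuous_gieseker_density a : continuous (gieseker_density a).
Proof.
move=> x; pose e := frame_at E x.
have fe := frame_at_frames E x; have ex : fdom e x := frame_at_dom E x.
(* Near [x] the density is computed in the single frame [e]: a smooth function times a sum of
   squared moduli of holomorphic functions. *)
apply: (@continuous_at_near R X x (fun y =>
   complex.Re (q y (w e y) (w e y)) * frame_sqnorm tau a (fvec e y))).
  have : nbhs x (fdom e) by exact: (open_nbhs_nbhs (conj (fdom_open e) ex)).
  by apply: filterS => y ey; rewrite -gieseker_densityE.
apply: continuous_atM.
  exact: (smooth_on_continuous ex (q_metric.2 e fe).1).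
apply: continuous_at_sum => I.
have ct : {for x, continuous (fun y =>
    gieseker_form tau a I (tnth (fvec e y)) : C)}.
  apply: (@continuous_at_sum C) => m.
  apply: (@continuous_atM C); first exact: continuous_at_cst.
  exact: (holomorphic_on_continuous (fdom_open e) ex ((tau_H0 m).2 e fe)).
have sq (h : C -> R) : continuous h -> {for x, continuous (fun y =>
    h (gieseker_form tau a I (tnth (fvec e y))) ^+ 2)}.
  move=> ch.
  have chx : {for x, continuous (fun y =>
      h (gieseker_form tau a I (tnth (fvec e y))))}.
    exact: (continuous_comp ct (ch _)).
  exact: continuous_atM.
by apply: continuous_atD; apply: sq; [exact: continuous_Re|exact: continuous_Im].
Qed.

Lemma gieseker_density_gt0 a x :
  0 < frame_sqnorm tau a (fvec (frame_at E x) x) -> 0 < gieseker_density a x.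
Proof.
move=> a0; have ex := frame_at_dom E x.
rewrite (gieseker_densityE _ ex) mulr_gt0//.
have := det_metric_wedge_gt0 (fvec_basis ex) (q_metric.1 x).
by rewrite ltcE => /andP[].
Qed.

Context (om : dform X 2) (mu : {measure set (borel X) -> \bar R}).
Hypothesis X_compact : compact [set: X].
Hypothesis mu_fin : (mu setT < +oo)%E.

Lemma integrable_ln_gieseker_density a :
  (forall x, 0 < gieseker_density a x) ->
  mu.-integrable [set: borel X]
    (EFin \o (fun x => ln (gieseker_density a x) / n`!%:R)).
Proof.
move=> a0; apply: integrable_continuous_borel => // x.
apply: (@continuous_atM R X x (fun y => ln (gieseker_density a y))).
  apply: (continuous_comp (@continuous_gieseker_density a x)).
  exact: continuous_ln.
exact: (@continuous_at_cst R X x).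
Qed.

(** Positivity of the density keeps the extended logarithm and its integral finite, so the
    extended-valued definition reduces to a real exponential. *)
Lemma gieseker_sqnormE a : (forall x, 0 < gieseker_density a x) ->
  gieseker_sqnorm om mu q tau a =
  expR ((kahler_volume om mu)^-1 *
        \int[mu]_x (ln (gieseker_density a x) / n`!%:R)).
Proof.
move=> a0; rewrite /gieseker_sqnorm.
have iln := integrable_ln_gieseker_density a0.
rewrite (_ : (\int[mu]_x _)%E =
  (\int[mu]_x (ln (gieseker_density a x) / n`!%:R))%:E)//.
rewrite /Rintegral fineK; last exact: integrable_fin_num.
apply: eq_integral => x _.
by rewrite -[X in lne X%:E]/(gieseker_density a x) lne_EFin.
Qed.

End DetMetric.

(* The functional [L] and the norm of the Gieseker point *)
Local Close Scope complex_scope.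

Theorem theorem2 (R : realType) (n r N k : nat)
    (X : complex_manifold R n) (X_compact : compact [set: X])
    (w : dform X 2) (w_kahler : kahler_form w)
    (mu : {measure set (borel X) -> \bar R})
    (mu_volume : measure_of_form (wedge_pow w n) mu)
    (E : holo_bundle X r)
    (s : 'I_N -> dual_section E)
    (s_holomorphic : forall i, holomorphic_dual (s i))
    (s_generates : generates_dual s)
    (tau : 'I_k -> det_dual_section E) (tau_basis : H0_det_dual_basis tau)
    (q : forall x, (('I_r -> E x) -> R[i]^o) -> (('I_r -> E x) -> R[i]^o) -> R[i])
    (q_metric : det_dual_metric q)
    (k0 : forall x, E x -> E x -> R[i]) (k0_metric : hermitian_metric k0)
    (T : gieseker_space R r N k) (T_gieseker : is_gieseker_point s tau T)
    (sigma : 'M[R[i]]_N) (sigma_SL : \det sigma = 1) :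
  let c := slope_const w mu k0 in
  let h := pullback_metric (embed s) in
  let h_sigma := pullback_metric (fun x e => sigma *m embed s e) in
  L_functional w mu c h h_sigma =
  c * ln (gieseker_sqnorm w mu q tau (gieseker_act sigma T) /
          gieseker_sqnorm w mu q tau T).
Proof.
move=> c h h_sigma.
have [tau_H0 _ _] := tau_basis.
have mu_fin : (mu setT < +oo)%E.
  apply: compact_measure_lty => //.
  exact: kahler_measure_locally_finite w_kahler mu_volume.
pose b x := fvec (frame_at E x) x.
have basisb x : basis_of fullv (b x).
  exact: fvec_basis (frame_at_dom E x).
have formT x I := gieseker_form_embed I (b x) T_gieseker.
have formS x I := gieseker_form_act_embed sigma I (b x) T_gieseker.
have gramT x : gram_det h (b x) = (real_complex _ (frame_sqnorm tau T (b x))).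
  rewrite gram_det_pullback; congr real_complex_def.
  by apply: eq_bigr => I _; rewrite formT.
have gramS x : gram_det h_sigma (b x) =
    (real_complex _ (frame_sqnorm tau (gieseker_act sigma T) (b x))).
  rewrite gram_det_pullback frame_matrix_mulmx; congr real_complex_def.
  by apply: eq_bigr => I _; rewrite formS.
have posT x : 0 < frame_sqnorm tau T (b x).
  have [B BA] := generates_left_inverse s_generates (basisb x).
  exact: frame_sqnorm_gt0 (formT x) BA.
have posS x : 0 < frame_sqnorm tau (gieseker_act sigma T) (b x).
  have [B BA] := generates_left_inverse s_generates (basisb x).
  (* Invertibility of [sigma] turns a left inverse [B] of [A] into the left inverse
     [B *m invmx sigma] of [sigma *m A]. *)
  have sigmaU : sigma \in unitmx by rewrite unitmxE sigma_SL unitr1.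
  apply: (frame_sqnorm_gt0 (B := B *m invmx sigma) (formS x)).
  by rewrite -mulmxA mulKmx.
have dens0 (a : gieseker_space R r N k) :
    (forall x, 0 < frame_sqnorm tau a (b x)) ->
    forall x, 0 < gieseker_density tau q a x.
  by move=> a0 x; exact: gieseker_density_gt0.
have int_ln a := @integrable_ln_gieseker_density _ _ _ _ _ N _ _ _
  q_metric tau_H0 _ X_compact mu_fin a.
have normE a := @gieseker_sqnormE _ _ _ _ _ N _ _ _
  q_metric tau_H0 w _ X_compact mu_fin a.
have iT := int_ln _ (dens0 _ posT).
have iS := int_ln _ (dens0 _ posS).
rewrite (normE _ (dens0 _ posT)) (normE _ (dens0 _ posS)).
(* The logarithm of the quotient of exponentials is the difference of the two integrals over the
   volume; integrability merges them into one integral, to be compared pointwise. *)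
rewrite -expRN -expRD expRK -mulrBr mulrA /L_functional -RintegralB//.
congr (_ * _); apply: eq_Rintegral => x _.
rewrite -mulrBl; congr (_ / _).
have ex := frame_at_dom E x.
rewrite !(gieseker_densityE q_metric tau_H0 _ ex) -/(b x).
have q0 := det_metric_wedge_gt0 (fvec_basis ex) (q_metric.1 x).
move: q0; rewrite ltcE => /andP[_ /= q0].
(* Both densities carry the same positive factor [q0], so their quotient is the quotient of the Gram
   determinants. *)
rewrite /det_ratio -/(b x) gramT gramS -fmorphV -rmorphM /=.
by rewrite -ln_div ?posrE ?mulr_gt0// -mulf_div divff ?mul1r// gt_eqF.
Qed.
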